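(* For every ring grooming instance with uniform traffic ($d_{jk}=d\ge 1$ for all $j\ne k$), Algorithm A produces a feasible routing whose number of ADMs is at most $12\sqrt2\, m$, where $m$ is the minimum number of ADMs for the instance.
   Context: Ring grooming. An instance consists of integers $n\ge 2$ (ring size) and $c\ge 1$ (capacity), and a finite list $L$ of unordered pairs $\{j,k\}$ with $j\ne k$, $j,k\in\{1,\dots,n\}$ (repetitions allowed); these are the traffic demands. Let $d_{jk}=d_{kj}$ be the number of times $\{j,k\}$ occurs in $L$. Let $C_n$ be the cycle graph on vertices $1,\dots,n$ in cyclic order. A solution uses some finite number of ''rings'', each a copy of $C_n$ with capacity $c$ on every edge. A routing specifies, for every ring $i$ and every pair $j<k$, nonnegative integers $t^0_{ijk},t^1_{ijk}$ (amounts of $\{j,k\}$-traffic on ring $i$ along each of the two arcs of $C_n$ between $j$ and $k$); it is feasible if $\sum_i(t^0_{ijk}+t^1_{ijk})=d_{jk}$ for all $j<k$ and on every ring every edge carries total traffic at most $c$. Ring $i$ needs an ADM at vertex $j$ iff some traffic with endpoint $j$ is routed on ring $i$; the cost is the total number of ADMs, and $m$ is the minimum cost. Algorithm A (uniform traffic $d$, $f=d/(2c)$). If $f\ge 1$: for each pair $j<k$, use $\lceil f\rceil$ rings on which only $\{j,k\}$-traffic is routed (so each has ADMs only at $j$ and $k$), splitting the $d$ units among them feasibly. If $f<1$: let $M=\lfloor\sqrt{2/f}\rfloor$ if $2\le\lfloor\sqrt{2/f}\rfloor\le n$, $M=2$ if $\lfloor\sqrt{2/f}\rfloor<2$, and $M=n$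 if $\lfloor\sqrt{2/f}\rfloor>n$. Let $\mu=\lfloor M/2\rfloor$ and let $F$ be a family of $\lceil n/\mu\rceil$ subsets of $\{1,\dots,n\}$, each of size $\mu$, whose union is $\{1,\dots,n\}$. For each unordered pair of distinct members of $F$, form a block equal to their union, enlarged if necessary by arbitrary further vertices to have exactly $M$ elements (if $F$ has a single member, take the single block $\{1,\dots,n\}$); discard duplicate blocks. Every pair $\{j,k\}$ then lies in some block. Process the blocks in turn: for each block, create a ring and route on it all demands between vertices of the block that have not been routed on a previous ring, using, for each such pair, $\lfloor d/2\rfloor$ units on the longer arc and $\lceil d/2\rceil$ units on the shorter arc (ties broken arbitrarily). Finally discard ADMs at which no traffic terminates. *)

(* Defs.v *)
From HB Require Import structures.
From mathcomp Require Import all_boot all_order all_algebra.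
Set Implicit Arguments. Unset Strict Implicit. Unset Printing Implicit Defensive.

(* Vertices of the ring C_n are 0, ..., n-1 (type 'I_n), in cyclic order.
   Edge e : 'I_n is the edge {e, e+1 mod n}.
   For a pair j < k, arc 0 (boolean index false) is the arc j, j+1, ..., k
   (edges e with j <= e < k); arc 1 (index true) is the complementary arc. *)

(* A routing: a number of rings and the traffic amounts
   traf i j k b = t^b_{ijk} (only meaningful for i < nrings, j < k). *)
Record routing (n : nat) := Routing {
  nrings : nat;
  traf : nat -> 'I_n -> 'I_n -> bool -> nat }.

Definition on_arc0 n (j k e : 'I_n) : bool := (j <= e) && (e < k).

Definition load n (R : routing n) (i : nat) (e : 'I_n) : nat :=
  \sum_(j : 'I_n) \sum_(k : 'I_n | j < k)
     (if on_arc0 j k e then traf R i j k false else traf R i j k true).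

Definition feasible n (c : nat) (dem : 'I_n -> 'I_n -> nat) (R : routing n)
  : Prop :=
  (forall j k : 'I_n, j < k ->
     \sum_(i < nrings R) (traf R i j k false + traf R i j k true) = dem j k)
  /\ (forall i, i < nrings R -> forall e : 'I_n, load R i e <= c).

Definition pairtraf n (R : routing n) (i : nat) (j k : 'I_n) : nat :=
  if j < k then traf R i j k false + traf R i j k true
  else traf R i k j false + traf R i k j true.

Definition has_adm n (R : routing n) (i : nat) (j : 'I_n) : bool :=
  [exists k : 'I_n, (k != j) && (0 < pairtraf R i j k)].

Definition cost n (R : routing n) : nat :=
  \sum_(i < nrings R) #|[set j : 'I_n | has_adm R i j]|.

Definition is_min_cost n (c : nat) (dem : 'I_n -> 'I_n -> nat) (m : nat)
  : Prop :=
  (exists R, feasible c dem R /\ cost R = m) /\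
  (forall R, feasible c dem R -> m <= cost R).

Definition uniform_dem n (d : nat) : 'I_n -> 'I_n -> nat := fun _ _ => d.

Definition ceildiv (a b : nat) : nat := (a + b.-1) %/ b.

(* ---------------- Algorithm A ----------------
   alg_A_output n c d R nadm : R is a possible output of Algorithm A
   (for some admissible choice of the arbitrary choices it allows) and
   nadm is the number of ADMs it uses.  f = d/(2c). *)

(* Case f >= 1 (i.e. 2c <= d): ceil(f) rings per pair j<k carrying only
   {j,k}-traffic, with a feasible split; each ring has ADMs at j and k. *)
Definition alg_A_big n (c d : nat) (R : routing n) (nadm : nat) : Prop :=
  exists p : nat -> 'I_n * 'I_n,
  [/\ forall i, i < nrings R -> (p i).1 < (p i).2,
      forall j k : 'I_n, j < k ->
        #|[set i : 'I_(nrings R) | p i == (j, k)]| = ceildiv d (2 * c),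
      forall i (j k : 'I_n) b, i < nrings R -> j < k -> (j, k) != p i ->
        traf R i j k b = 0,
      feasible c (@uniform_dem n d) R
    & nadm = 2 * nrings R].

Definition routed_here n (bs : seq {set 'I_n}) (i : nat) (j k : 'I_n) : bool :=
  [&& j \in nth set0 bs i, k \in nth set0 bs i &
      ~~ has (fun B : {set 'I_n} => (j \in B) && (k \in B)) (take i bs)].

(* Case f < 1 (i.e. d < 2c). M0 = floor(sqrt(2/f)) = floor(sqrt(4c/d)) is
   characterised by M0^2 d <= 4c < (M0+1)^2 d. *)
Definition alg_A_small n (c d : nat) (R : routing n) (nadm : nat) : Prop :=
  exists (M0 M : nat) (F : seq {set 'I_n}) (blk : nat -> nat -> {set 'I_n})
         (bs : seq {set 'I_n}),
  let mu := M./2 in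
  M0 ^ 2 * d <= 4 * c < M0.+1 ^ 2 * d /\
      M = (if M0 < 2 then 2 else if n < M0 then n else M0) /\
      size F = ceildiv n mu /\
      (forall A, A \in F -> #|A| = mu) /\
      (\bigcup_(A <- F) A = [set: 'I_n]) /\
      (forall a b, a < b < size F ->
         (nth set0 F a :|: nth set0 F b) \subset blk a b /\ #|blk a b| = M) /\
      (* bs: the blocks without duplicates, in the processing order *)
      uniq bs /\
      (forall B, B \in bs <->
         ((size F = 1 /\ B = [set: 'I_n]) \/
          (size F <> 1 /\ exists a b, a < b < size F /\ B = blk a b))) /\
      nrings R = size bs /\
      (forall i (j k : 'I_n), i < size bs -> j < k ->
         if routed_here bs i j k then
           (traf R i j k false = uphalf d /\ traf R i j k true = d./2 /\
              k - j <= n - (k - j)) \/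
           (traf R i j k false = d./2 /\ traf R i j k true = uphalf d /\
              n - (k - j) <= k - j)
         else traf R i j k false = 0 /\ traf R i j k true = 0) /\
    (* after discarding ADMs at which no traffic terminates *)
      nadm = cost R.

Definition alg_A_output n (c d : nat) (R : routing n) (nadm : nat) : Prop :=
  if 2 * c <= d then alg_A_big c d R nadm else alg_A_small c d R nadm.

(* Main.v *)
(* Lower bound: on one ring let A be the set of its ADM vertices, and measure
   each unit of traffic by the number of vertices of A on its arc (its hops).
   Adding up the loads of the edges that follow the vertices of A, the total
   number of hops is at most c|A|.  From a given ADM, at most d units travel
   exactly r hops clockwise, so for every h the ring carries at most
   |A| (c/h + d(h-1)/2) units; hence h n(n-1)d <= m (2c + d h(h-1)).
   When f >= 1 take h = 1: Algorithm A is then within a factor 2.  When f < 1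
   take h = mu + 1 and compare with the at most s(s-1)/2 blocks of size M,
   where s = ceil(n/mu): the factor is 15.  If M was cut down to n, then s <= 3
   and m >= n suffice.  Finally 16 <= 12 sqrt 2.
   Feasibility when f < 1: the shorter arc of a pair contains an edge e only if
   e separates the pair into its right and left half-rings, so at most M^2/4
   pairs of a block put their odd unit on e. *)
Require Import Defs.
From HB Require Import structures.
From mathcomp Require Import all_boot all_order all_algebra.
From mathcomp Require Import zify.
Import GRing.Theory Num.Theory.

(** * Sums over ordered and unordered pairs *)

Lemma sum_ltn_sym {n} (F : 'I_n -> 'I_n -> nat) :
  \sum_(j : 'I_n) \sum_(k : 'I_n | j < k) (F j k + F k j) =
  \sum_(j : 'I_n) \sum_(k : 'I_n | k != j) F j k.
Proof.
transitivity (\sum_(j : 'I_n) (\sum_(k : 'I_n | j < k) F j k +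
                               \sum_(k : 'I_n | k < j) F j k)).
  under eq_bigr do rewrite big_split /=.
  rewrite !big_split /=; congr addn.
  by rewrite (exchange_big_dep xpredT).
apply: eq_bigr => j _; rewrite [RHS](bigID (fun k : 'I_n => j < k)) /=.
by congr addn; apply: eq_bigl => k; rewrite -(inj_eq val_inj) /=; lia.
Qed.

Lemma sum_ltn_const n a :
  2 * (\sum_(j < n) \sum_(k < n | j < k) a) = n * n.-1 * a.
Proof.
rewrite mul2n -addnn -big_split /=; under eq_bigr do rewrite -big_split /=.
rewrite (sum_ltn_sym (fun _ _ => a)).
transitivity (\sum_(j < n) n.-1 * a); last by rewrite sum_nat_const card_ord; lia.
apply: eq_bigr => j _; rewrite sum_nat_const; congr muln.
by have := cardC1 j; rewrite card_ord.
Qed.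

(** * Hop counting and the lower bound on the cost *)

Section LowerBound.
Variables (n : nat).
Implicit Types (u v e : 'I_n) (A : {set 'I_n}).

(* Number of edges of the clockwise arc from u to v. *)
Definition cw u v : nat := if u <= v then v - u else v + n - u.

Lemma cw_inj u : injective (cw u).
Proof.
move=> v w; rewrite /cw => h; apply: val_inj => /=.
by have := ltn_ord v; have := ltn_ord w; have := ltn_ord u; move: h; do 2!case: ifP; lia.
Qed.

(** An edge is named by its first vertex, so the arc from [u] to [v] is taken with [u] and without
    [v]. *)
Definition hop A u v : nat := #|[set e in A | cw u e < cw u v]|.

(** If [v] comes before [w] clockwise from [u], the arc to [w] contains [v] besides the arc to [v],
    so hops strictly increase along [A]. *)
Lemma hop_inj A u : {in A &, injective (hop A u)}.
Proof.
move=> v w vA wA.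
wlog le : v w vA wA / cw u v <= cw u w.
  by move=> W h; case: (leqP (cw u v) (cw u w)) => [|/ltnW] /W; [exact|move=> ->].
move=> h; apply: (@cw_inj u); apply/eqP; rewrite eqn_leq le leqNgt.
apply/negP => lt; move: h; apply/eqP; rewrite neq_ltn; apply/orP; left.
apply: proper_card; apply/properP; split.
  by apply/subsetP => e; rewrite !inE => /andP[-> ?]; apply: leq_trans le.
by exists v; rewrite !inE ?vA // ltnn.
Qed.

Lemma sub_sum_leq a h : h - a = \sum_(r < h) (a <= r).
Proof.
elim: h => [|h IH]; first by rewrite big_ord0 sub0n.
by rewrite big_ord_recr /= -IH; lia.
Qed.

(** The hops from [u] are distinct and positive ([u] itself is counted), so at most [r] vertices
    have hop at most [r]; this is summed over [r < h]. *)
Lemma sum_hop_le A u h : u \in A ->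
  2 * (\sum_(v in A :\ u) (h - hop A u v)) <= h * h.-1.
Proof.
move=> uA; under eq_bigr do rewrite sub_sum_leq.
rewrite exchange_big /= -[X in _ <= X]muln1 -sum_ltn_const mul2n -muln2 mulnC.
rewrite leq_mul2l /= [X in _ <= X](exchange_big_dep xpredT) //=.
apply: leq_sum => r _.
rewrite sum1_card -big_mkcondr /= sum1_card.
pose S := [set v in A :\ u | hop A u v <= r].
have -> : #|[pred v in A :\ u | hop A u v <= r]| = #|S|.
  by apply: eq_card => v; rewrite !inE.
have -> : #|[pred i : 'I_h | i < r]| = r.
  rewrite -sum1_card -(big_ord_widen h (fun=> 1)) ?sum1_card ?card_ord //.
  exact: ltnW.
rewrite -(size_iota 1 r) cardE -(size_map (hop A u)).
apply: uniq_leq_size.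
  rewrite map_inj_in_uniq ?enum_uniq // => v w.
  rewrite !mem_enum !inE => /andP[/andP[_ vA] _] /andP[/andP[_ wA] _].
  exact: hop_inj.
move=> x /mapP[v]; rewrite mem_enum !inE => /andP[/andP[vu vA] le] ->.
rewrite mem_iota add1n ltnS le andbT card_gt0.
apply/set0Pn; exists u; rewrite !inE uA /cw leqnn subnn.
have := ltn_ord u; have := ltn_ord v.
by move: vu; rewrite -(inj_eq val_inj) /=; case: ifP; lia.
Qed.

(* Amount of {u, v}-traffic on the clockwise arc from u to v. *)
Definition cwtraf (R : routing n) i u v : nat :=
  if u < v then traf R i u v false else traf R i v u true.

(** Double counting: a unit on the clockwise arc from [u] to [v] loads [hop A u v] edges of [A]. For
    j < k, arc 1 runs clockwise from k to j. *)
Lemma sum_load_hop (R : routing n) i A :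
  \sum_(e in A) load R i e =
  \sum_u \sum_(v | v != u) cwtraf R i u v * hop A u v.
Proof.
rewrite -sum_ltn_sym exchange_big; apply: eq_bigr => j _.
rewrite exchange_big; apply: eq_bigr => k ltjk.
rewrite (bigID (on_arc0 j k)) /= /cwtraf ltjk ltnNge (ltnW ltjk) /=.
have := ltn_ord j; have := ltn_ord k => ltk ltj.
congr addn.
  under eq_bigr => e /andP[_ ->] do [].
  rewrite sum_nat_const mulnC; congr muln; apply: eq_card => e.
  rewrite !inE unfold_in /on_arc0 /cw (ltnW ltjk); congr andb.
  by have := ltn_ord e; case: ifP; lia.
under eq_bigr => e /andP[_ /negPf->] do [].
rewrite sum_nat_const mulnC; congr muln; apply: eq_card => e.
rewrite !inE unfold_in /on_arc0 /cw (leqNgt k j) ltjk /=; congr andb.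
by have := ltn_ord e; case: ifP; lia.
Qed.

Definition total (R : routing n) i : nat :=
  \sum_(j : 'I_n) \sum_(k : 'I_n | j < k) (traf R i j k false + traf R i j k true).

Lemma total_cwtraf (R : routing n) i :
  total R i = \sum_u \sum_(v | v != u) cwtraf R i u v.
Proof.
rewrite -sum_ltn_sym; apply: eq_bigr => j _; apply: eq_bigr => k ltjk.
by rewrite /cwtraf ltjk ltnNge (ltnW ltjk).
Qed.

Lemma cwtraf_adm (R : routing n) i u v :
  v != u -> 0 < cwtraf R i u v -> has_adm R i u && has_adm R i v.
Proof.
move=> vu pos; apply/andP; split; apply/existsP; [exists v|exists u].
  rewrite vu /pairtraf; move: pos; rewrite /cwtraf; case: ifP => //=; lia.
rewrite eq_sym vu /pairtraf; move: pos vu; rewrite /cwtraf -(inj_eq val_inj) /=.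
by case: (ltngtP u v) => //=; lia.
Qed.

(** Traffic t <= d making x hops satisfies h t <= t x + d (h - x), with truncated difference. Summed
    over pairs, the first term is the load on the edges of [A], and [sum_hop_le] bounds the
    second. *)
Lemma total_le (R : routing n) c d i h :
  feasible c (@uniform_dem n d) R -> i < nrings R ->
  2 * (h * total R i) <=
  #|[set j | has_adm R i j]| * (2 * c + d * (h * h.-1)).
Proof.
move=> [demR loadR] ltiR; set A := [set j | _].
have tle u v : v != u -> cwtraf R i u v <= d.
  rewrite -(inj_eq val_inj) /= /cwtraf => vu.
  have aux (j k : 'I_n) : j < k -> traf R i j k false + traf R i j k true <= d.
    move=> /demR; rewrite /uniform_dem => <-.
    by rewrite (bigD1 (Ordinal ltiR)) //= leq_addr.
  case: ifP => [/aux|uv]; first lia.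
  by have /aux : v < u by [lia]; lia.
have loadA : \sum_(e in A) load R i e <= #|A| * c.
  by rewrite -sum_nat_const; apply: leq_sum => e _; apply: loadR.
have key : h * total R i <= \sum_(e in A) load R i e +
    d * \sum_(u in A) \sum_(v in A :\ u) (h - hop A u v).
  rewrite sum_load_hop total_cwtraf !big_distrr [X in _ + X]big_mkcond -big_split /=.
  apply: leq_sum => u _; case: ifP => uA; last first.
    rewrite addn0 big_distrr /=; apply: leq_sum => v vu.
    case: (posnP (cwtraf R i u v)) => [->|/(cwtraf_adm _ _ _ _ vu)];
      first by rewrite muln0.
    by move: uA; rewrite inE => ->.
  have -> : \sum_(v in A :\ u) (h - hop A u v) =
      \sum_(v | v != u) (if v \in A then h - hop A u v else 0).
    by rewrite -big_mkcondr; apply: eq_bigl => v; rewrite in_setD1.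
  rewrite !big_distrr -big_split /=; apply: leq_sum => v vu.
  case: ifP => vA; last first.
    case: (posnP (cwtraf R i u v)) => [->|/(cwtraf_adm _ _ _ _ vu)];
      first by rewrite muln0.
    by move: vA; rewrite inE => ->; rewrite andbF.
  have := tle u v vu; nia.
have hopA : 2 * (\sum_(u in A) \sum_(v in A :\ u) (h - hop A u v)) <= #|A| * (h * h.-1).
  by rewrite big_distrr -sum_nat_const; apply: leq_sum => u uA; apply: sum_hop_le.
nia.
Qed.

Lemma cost_lower_bound (R : routing n) c d h :
  feasible c (@uniform_dem n d) R ->
  h * (n * n.-1 * d) <= cost R * (2 * c + d * (h * h.-1)).
Proof.
move=> feasR; have [demR _] := feasR.
rewrite -sum_ltn_const /cost big_distrl /=.
have -> : \sum_(j < n) \sum_(k < n | j < k) d = \sum_(i < nrings R) total R i.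
  rewrite exchange_big; apply: eq_bigr => j _; rewrite exchange_big.
  by apply: eq_bigr => k /demR.
rewrite mulnCA !big_distrr; apply: leq_sum => i _.
by apply: total_le.
Qed.

Lemma cost_ge_size (R : routing n) c d :
  2 <= n -> 1 <= d -> feasible c (@uniform_dem n d) R -> n <= cost R.
Proof.
move=> n2 d1 [demR _].
rewrite /cost -{1}(card_ord n) -sum1_card.
under [X in _ <= X]eq_bigr do rewrite -sum1_card big_mkcond.
rewrite exchange_big; apply: leq_sum => j _ /=.
have [k kj] : exists k : 'I_n, k != j.
  apply/existsP; rewrite -negb_forall; apply/negP => /forallP eqj.
  (* Vertices 0 and 1 cannot both equal [j]. *)
  have := eqj (Ordinal (leq_trans (isT : 0 < 2) n2)).
  have := eqj (Ordinal n2); rewrite -!(inj_eq val_inj) /=; lia.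
have : 0 < \sum_(i < nrings R) pairtraf R i j k.
  rewrite /pairtraf; move: kj; rewrite -(inj_eq val_inj) /=.
  case: (ltngtP j k) => [lt|lt|/val_inj eqjk] /=; rewrite ?eqjk ?eqxx // => _;
    exact: (leq_trans d1 (eq_leq (esym (demR _ _ lt)))).
rewrite lt0n sum_nat_eq0 negb_forall => /existsP[i] /=; rewrite -lt0n => pos.
rewrite (bigD1 i) //= inE; have -> // : has_adm R i j.
by apply/existsP; exists k; rewrite kj.
Qed.
End LowerBound.

(** * The load that one block puts on an edge *)

Section Load.
Variables (n : nat).
Implicit Types (B : {set 'I_n}) (j k e : 'I_n).

Lemma sum_pairs_in B :
  2 * (\sum_(j : 'I_n) \sum_(k : 'I_n | j < k) ((j \in B) && (k \in B))) =
  #|B| * #|B|.-1.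
Proof.
rewrite mul2n -addnn -big_split /=; under eq_bigr do rewrite -big_split /=.
under eq_bigr do under eq_bigr do rewrite [X in _ + nat_of_bool X]andbC.
rewrite (sum_ltn_sym (fun j k => (j \in B) && (k \in B) : nat)).
rewrite -sum_nat_const [RHS]big_mkcond; apply: eq_bigr => j _.
case: (boolP (j \in B)) => jB /=; last by rewrite big1.
rewrite -big_mkcondr sum1_card; transitivity #|B :\ j|; last by rewrite (cardsD1 j B) jB.
by apply: eq_card => k; rewrite !inE.
Qed.

(* v lies in the half ring that follows e clockwise. *)
Definition near_right e v : bool := 2 * (if e < v then v - e else v + n - e) <= n.

(** Clockwise distances from [e] run over 1, ..., n, with [e] itself at n. If an arc of length L <=
    n/2 contains [e], its last vertex is at distance at most L and its first vertex is n - L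
    further, hence beyond n/2. *)
Lemma near_right_neq e j k : j < k ->
  (if on_arc0 j k e then k - j <= n - (k - j) else n - (k - j) <= k - j) ->
  near_right e j != near_right e k.
Proof.
move=> ltjk; have := ltn_ord k; have := ltn_ord e.
rewrite /on_arc0 /near_right => lte ltk.
case: (leqP j e) => je; case: (ltnP e k) => ek /=; lia.
Qed.

(** The counted pairs join the x elements of [B] satisfying [P] to the y others, and 4xy <= (x +
    y)^2. *)
Lemma sum_pairs_cross B (P : pred 'I_n) :
  4 * (\sum_(j : 'I_n) \sum_(k : 'I_n | j < k)
        [&& j \in B, k \in B & P j != P k]) <= #|B| ^ 2.
Proof.
pose F j k := [&& j \in B, P j, k \in B & ~~ P k] : nat.
apply: (@leq_trans (4 * (\sum_(j : 'I_n) \sum_(k : 'I_n | k != j) F j k))).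
  rewrite leq_mul2l -sum_ltn_sym /=; apply: leq_sum => j _; apply: leq_sum => k _.
  by rewrite /F; do 2!case: (_ \in B); do 2!case: (P _).
apply: (@leq_trans (4 * (#|B :&: [set j | P j]| * #|B :\: [set j | P j]|))).
  rewrite leq_mul2l -sum_nat_const [X in _ <= X]big_mkcond /=.
  apply: leq_sum => j _; rewrite !inE -sum1_card /F.
  case: (j \in B) => /=; last by rewrite big1.
  case: (P j) => /=; last by rewrite big1.
  rewrite big_mkcond [X in _ <= X]big_mkcond; apply: leq_sum => k _.
  by rewrite !inE; case: (k != j); case: (k \in B); case: (P k).
rewrite -(cardsID [set j | P j] B); exact: (nat_AGM2 _ _).1.
Qed.

(** Here [t j k] stands for the load of the pair on [e]: floor(d/2) whichever arc contains [e], plus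
    the odd unit only if [e] separates the pair. *)
Lemma block_load_le B d e (t : 'I_n -> 'I_n -> nat) :
  (forall j k, j < k -> t j k <=
     ((j \in B) && (k \in B)) * d./2 +
     [&& j \in B, k \in B & near_right e j != near_right e k] * odd d) ->
  4 * (\sum_(j : 'I_n) \sum_(k : 'I_n | j < k) t j k) <=
  2 * (#|B| * #|B|.-1) * d./2 + odd d * #|B| ^ 2.
Proof.
move=> le_t; rewrite -sum_pairs_in; have := sum_pairs_cross B (near_right e).
set X := \sum_j _; set Y := (X in 2 * (2 * X)) => le4X.
suff : \sum_(j : 'I_n) \sum_(k : 'I_n | j < k) t j k <= Y * d./2 + X * odd d.
  move: (X) (Y) (d./2) (#|B| ^ 2) le4X => x y h b; case: (odd d) => /=; lia.
rewrite !big_distrl -big_split /=; apply: leq_sum => j _.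
by rewrite !big_distrl -big_split /=; apply: leq_sum => k /le_t.
Qed.
End Load.

Lemma ceildiv_bounds a b : 0 < b -> a <= ceildiv a b * b < a + b.
Proof.
move=> b0; rewrite /ceildiv; have := leq_divM (a + b.-1) b.
by have := ltn_ceil (a + b.-1) b0; lia.
Qed.

(** A covered pair is routed on exactly one ring, that of the first block containing it. *)
Lemma routed_here_find n (bs : seq {set 'I_n}) i j k :
  has (fun B : {set 'I_n} => (j \in B) && (k \in B)) bs ->
  routed_here bs i j k =
  (i == find (fun B : {set 'I_n} => (j \in B) && (k \in B)) bs).
Proof.
move=> hasB; rewrite /routed_here andbA has_take //.
case: (ltngtP i (find _ bs)) => [lt|_|->]; rewrite ?andbF ?andbT //.
  exact: before_find lt.
exact: nth_find hasB.
Qed.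

(** * Algorithm A for f < 1: feasibility and ratio *)

Section SmallDemands.
Variables (n c d : nat).
Hypotheses (n2 : 2 <= n) (d1 : 1 <= d) (d2c : d < 2 * c).

(** The third property is the capacity bound matching [block_load_le]. The fourth serves the ratio:
    unless M is cut to n, 4c < (M0 + 1)^2 d and M0 + 1 <= 2 ([M./2] + 1). *)
Lemma block_size_props M0 M : M0 ^ 2 * d <= 4 * c < M0.+1 ^ 2 * d ->
  M = (if M0 < 2 then 2 else if n < M0 then n else M0) ->
  [/\ 2 <= M, M <= n,
      2 * (M * M.-1) * d./2 + odd d * M ^ 2 <= 4 * c
    & 2 * c <= 2 * (M./2.+1 ^ 2 * d) \/ M = n].
Proof.
move=> /andP[lo hi] ->; have := odd_double_half d; rewrite -mul2n => dE.
case: (ltnP M0 2) => [lt2|ge2].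
  (* With M = 2 the capacity bound reads ceil(d/2) <= c, true as d < 2c. *)
  split=> //; first by case: (odd d) dE => /=; lia.
  by left; move: hi; case: M0 lo lt2 => [|[|]] //=; lia.
(* Replacing x(x-1) by x^2 bounds the left side by x^2 d. *)
have cap x : x <= M0 -> 2 * (x * x.-1) * d./2 + odd d * x ^ 2 <= 4 * c.
  move=> xM0; apply: (@leq_trans (x ^ 2 * d)).
    have : x * x.-1 <= x ^ 2 by rewrite leq_mul2l leq_pred orbT.
    by move: (x * _) (x ^ 2) => y z yz; rewrite -[in X in _ <= X]dE; nia.
  by apply: leq_trans lo; rewrite leq_mul2r leq_exp2r ?xM0 ?orbT.
case: (ltnP n M0) => [ltn|gen]; split => //; [|by right| |].
- exact/cap/ltnW.
- exact: cap.
- left; have := odd_double_half M0; rewrite -mul2n.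
  case: (odd M0) => /=; nia.
Qed.

Section Output.
Variables (M : nat) (F : seq {set 'I_n}) (blk : nat -> nat -> {set 'I_n}).
Variables (bs : seq {set 'I_n}) (R : routing n).
Hypotheses (M2 : 2 <= M) (Mn : M <= n).
Hypothesis sizeF : size F = ceildiv n M./2.
Hypothesis coverF : \bigcup_(A <- F) A = [set: 'I_n].
Hypothesis blkP : forall a b, a < b < size F ->
  (nth set0 F a :|: nth set0 F b) \subset blk a b /\ #|blk a b| = M.
Hypothesis uniq_bs : uniq bs.
Hypothesis bsP : forall B, B \in bs <->
  ((size F = 1 /\ B = [set: 'I_n]) \/
   (size F <> 1 /\ exists a b, a < b < size F /\ B = blk a b)).
Hypothesis nringsR : nrings R = size bs.
Hypothesis trafR : forall i (j k : 'I_n), i < size bs -> j < k ->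
  if routed_here bs i j k then
    (traf R i j k false = uphalf d /\ traf R i j k true = d./2 /\
       k - j <= n - (k - j)) \/
    (traf R i j k false = d./2 /\ traf R i j k true = uphalf d /\
       n - (k - j) <= k - j)
  else traf R i j k false = 0 /\ traf R i j k true = 0.

Lemma mu_gt0 : 0 < M./2. Proof. by lia. Qed.

(** Since mu <= n/2, the ceiling of n/mu is at least 2; hence every block is some [blk a b]. *)
Lemma sizeF_ge2 : 2 <= size F.
Proof. by rewrite sizeF; have := ceildiv_bounds n M./2 mu_gt0; nia. Qed.

Lemma bs_block B : B \in bs -> exists a b, a < b < size F /\ B = blk a b.
Proof. by move=> /bsP[[sF]|[_]//]; have := sizeF_ge2; rewrite sF. Qed.

Lemma card_block B : B \in bs -> #|B| = M.
Proof. by move=> /bs_block[a [b [ab ->]]]; have [] := blkP _ _ ab. Qed.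

Lemma pair_covered j k :
  has (fun B : {set 'I_n} => (j \in B) && (k \in B)) bs.
Proof.
have inF v : exists2 a, a < size F & v \in nth set0 F a.
  have : v \in \bigcup_(A <- F) A by rewrite coverF inE.
  rewrite bigcup_seq => /bigcupP[A AF vA]; exists (index A F); first by rewrite index_mem.
  by rewrite nth_index.
have F2 := sizeF_ge2.
have inblk a b : a < b < size F -> j \in nth set0 F a :|: nth set0 F b ->
    k \in nth set0 F a :|: nth set0 F b ->
    has (fun B : {set 'I_n} => (j \in B) && (k \in B)) bs.
  move=> ab ja ka; have [/subsetP sub _] := blkP _ _ ab.
  apply/hasP; exists (blk a b); last by rewrite !sub.
  by apply/bsP; right; split; [lia|exists a, b].
have [a aF ja] := inF j; have [b bF kb] := inF k.
case: (ltngtP a b) => [lt|lt|eqab].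
- by apply: (inblk a b); rewrite ?lt ?bF // inE ?ja ?kb ?orbT.
- by apply: (inblk b a); rewrite ?lt ?aF // inE ?ja ?kb ?orbT.
(* If one member contains both vertices, its union with any other member will do. *)
- rewrite -eqab in kb; case: (posnP a) => [a0|a0].
    by apply: (inblk 0 1) => //; rewrite inE -a0 ?ja ?kb.
  by apply: (inblk 0 a); rewrite ?a0 ?aF // inE ?ja ?kb ?orbT.
Qed.

Lemma size_bs : 2 * size bs <= size F * (size F).-1.
Proof.
rewrite -[X in _ <= X]muln1 -sum_ltn_const leq_mul2l /=.
rewrite pair_big_dep /= sum1_card cardE.
rewrite -(size_map (fun q : 'I_(size F) * 'I_(size F) => blk q.1 q.2)).
apply: uniq_leq_size => // B /bs_block[a [b [/andP[ab bF] ->]]].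
apply/mapP; exists (Ordinal (ltn_trans ab bF), Ordinal bF) => //.
by rewrite mem_enum.
Qed.

Lemma small_cost : cost R <= size bs * M.
Proof.
rewrite /cost nringsR -[X in X * M]card_ord -sum_nat_const.
apply: leq_sum => i _; rewrite -(card_block (nth set0 bs i)) ?mem_nth //.
apply/subset_leq_card/subsetP => j; rewrite inE => /existsP[k /andP[kj]].
rewrite /pairtraf; move: kj; rewrite -(inj_eq val_inj) /=.
by case: (ltngtP j k) => // lt _; have := trafR i _ _ (ltn_ord i) lt;
  case: ifP => [/and3P[]|_ [-> ->]].
Qed.

Lemma small_feasible :
  2 * (M * M.-1) * d./2 + odd d * M ^ 2 <= 4 * c ->
  feasible c (@uniform_dem n d) R.
Proof.
move=> capM; have half := odd_double_half d.
have uph : uphalf d + d./2 = d by rewrite uphalf_half; lia.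
split=> [j k ltjk|i].
  have jkB := pair_covered j k; rewrite nringsR.
  have ltf := jkB; rewrite has_find in ltf.
  rewrite (bigD1 (Ordinal ltf)) //= big1 => [|i /negPf iNf].
    have := trafR _ _ _ ltf ltjk; rewrite (routed_here_find _ _ _ _ _ jkB) eqxx.
    by rewrite addn0 /uniform_dem; case=> [[-> [-> _]]|[-> [-> _]]]; lia.
  have := trafR _ _ _ (ltn_ord i) ltjk; rewrite (routed_here_find _ _ _ _ _ jkB).
  by rewrite -(inj_eq val_inj) /= in iNf; rewrite iNf => -[-> ->].
rewrite nringsR => lti e.
rewrite -(leq_pmul2l (isT : 0 < 4)); apply: leq_trans capM.
rewrite -(card_block (nth set0 bs i)) ?mem_nth //.
apply: (block_load_le _ _ _ e) => j k ltjk.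
have := trafR _ _ _ lti ltjk; case: ifP => [/and3P[-> -> _] /=|_ [-> ->]]; last first.
  by case: ifP.
have uph2 : uphalf d = d./2 + odd d by lia.
have := near_right_neq _ e j k ltjk.
by case: ifP => _ neq [[f [t le]]|[f [t le]]]; rewrite ?f ?t ?(neq le) ?uph2 /=; lia.
Qed.

Lemma small_ratio (R' : routing n) :
  2 * c <= 2 * (M./2.+1 ^ 2 * d) \/ M = n ->
  feasible c (@uniform_dem n d) R' -> cost R <= 16 * cost R'.
Proof.
move=> hM feasR'; apply: leq_trans small_cost _.
have := size_bs; rewrite sizeF; have /andP[] := ceildiv_bounds n M./2 mu_gt0.
have := mu_gt0; have Mmu : M <= M./2.*2.+1 by lia.
have mun : M./2 <= n by lia.
move: Mmu mun hM; move: (M./2) => mu.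
move: (ceildiv _ _) (size bs) => s N Mmu mun hM mu0 s_ge s_lt N_le.
case: hM => [c_le|Mn'].
  have lb := cost_lower_bound _ _ c d mu.+1 feasR'.
  (* With h = mu + 1, the bound on c makes 2c + d h(h-1) at most d (mu + 1)(3mu + 2), and 3mu + 2 <=
     5mu. *)
  have lb1 : n * n.-1 <= 5 * (cost R' * mu).
    apply: (@leq_trans (cost R' * (3 * mu + 2))); last by nia.
    rewrite -(leq_pmul2l (ltn0Sn mu)) -(leq_pmul2r d1) -mulnA; apply: leq_trans lb _.
    have -> : mu.+1 * (cost R' * (3 * mu + 2)) * d =
              cost R' * (2 * (mu.+1 ^ 2 * d) + d * (mu.+1 * mu)) by nia.
    by rewrite leq_mul2l leq_add2r c_le orbT.
  have s_le2 : s * mu <= 2 * n by lia.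
  have s_le1 : s.-1 * mu <= n.-1 by nia.
  have N_mu : 2 * N * (mu * mu) <= 2 * (n * n.-1).
    have := leq_mul s_le2 s_le1; nia.
  (* As M <= 2mu + 1 <= 3mu, [lb1] will give 2 N M mu^2 <= 30 mu^2 [cost R'], hence the factor
     15. *)
  have : (2 * N * (mu * mu)) * M <= 2 * (n * n.-1) * (3 * mu).
    by apply: leq_mul; lia.
  have mu2 : 0 < mu * mu by rewrite muln_gt0 mu0.
  rewrite -(leq_pmul2r mu2) => le1.
  suff : 2 * (n * n.-1) * (3 * mu) <= 30 * (cost R' * (mu * mu)) by nia.
  by have := leq_mul lb1 (leqnn (6 * mu)); nia.
have cost_n := cost_ge_size _ _ _ _ n2 d1 feasR'.
(* Now n <= 2mu + 1, so s mu < n + mu <= 3mu + 1 forces s <= 3; then N M <= 3n. *)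
have s3 : s <= 3 by nia.
have N3 : N <= 3 by nia.
nia.
Qed.
End Output.

Lemma alg_A_small_correct (R : routing n) nadm :
  alg_A_small c d R nadm ->
  feasible c (@uniform_dem n d) R /\
  forall R' : routing n, feasible c (@uniform_dem n d) R' -> nadm <= 16 * cost R'.
Proof.
case=> M0 [M [F [blk [bs [M0P [ME [sF [_ [cF [blkP [ubs [bsP [nR [tR ->]]]]]]]]]]]]]].
have [M2 Mn cap hM] := block_size_props _ _ M0P ME.
split=> [|R' feasR'].
  exact: (small_feasible M F blk bs).
exact: (small_ratio M F blk bs).
Qed.
End SmallDemands.

(** * Construction of an output for f < 1 *)

Lemma card_interval n b a : b + a <= n -> #|[set v : 'I_n | b <= v < b + a]| = a.
Proof.
move=> ban; rewrite -[RHS](size_iota b) cardE -(size_map val).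
apply/perm_size/uniq_perm; rewrite ?iota_uniq ?(map_inj_uniq val_inj) ?enum_uniq //.
move=> x; rewrite mem_iota; apply/mapP/idP => [[v]|xab].
  by rewrite mem_enum inE => ? ->.
have xn : x < n by lia.
by exists (Ordinal xn); rewrite // mem_enum inE.
Qed.

Lemma exists_superset (T : finType) (A : {set T}) m :
  #|A| <= m <= #|T| -> exists B : {set T}, (A \subset B) && (#|B| == m).
Proof.
move=> /andP[]; elim: m => [|m IH] leA leT.
  by exists A; rewrite subxx -leqn0.
case: (ltngtP #|A| m.+1) leA => // [lt _|eqA _]; last by exists A; rewrite subxx eqA eqxx.
have [B /andP[sAB /eqP cB]] := IH lt (ltnW leT).
have /set0Pn[x xB] : ~: B != set0.
  by rewrite -card_gt0 cardsCs setCK cB subn_gt0.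
exists (x |: B); rewrite (subset_trans sAB) ?subsetUr //=.
by rewrite cardsU1 cB -in_setC xB.
Qed.

Lemma alg_A_small_exists n c d : 2 <= n -> 1 <= d -> d < 2 * c ->
  exists R nadm, @alg_A_small n c d R nadm.
Proof.
move=> n2 d1 d2c.
have [M0 M0P] : exists M0, M0 ^ 2 * d <= 4 * c < M0.+1 ^ 2 * d.
  have ex0 : exists x, x ^ 2 * d <= 4 * c by exists 0.
  have bnd x : x ^ 2 * d <= 4 * c -> x <= 4 * c by nia.
  case: (ex_maxnP ex0 bnd) => x xP xmax; exists x; rewrite xP ltnNge.
  by apply/negP => /xmax; rewrite ltnn.
pose M := if M0 < 2 then 2 else if n < M0 then n else M0.
have [M2 Mn _ _] := block_size_props n c d n2 d1 d2c M0 M M0P (erefl M).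
pose mu := M./2; have mu0 : 0 < mu by rewrite /mu; lia.
have mun : 2 * mu <= n by rewrite /mu; lia.
have muM : 2 * mu <= M by rewrite /mu; lia.
(* The members of [F] are consecutive intervals of length mu, the last shifted back if needed to end
   at n - 1. *)
pose lo a := minn (a * mu) (n - mu).
pose A a := [set v : 'I_n | lo a <= v < lo a + mu].
have cardA a : #|A a| = mu by apply: card_interval; rewrite /lo; lia.
pose s := ceildiv n mu; pose F := mkseq A s.
pose U a b := nth set0 F a :|: nth set0 F b.
(* The default [set0] is not reached for a < b < [size F], as the union has at most 2mu <= M
   elements. *)
pose blk a b := odflt set0 [pick B : {set 'I_n} | (U a b \subset B) && (#|B| == M)].
have blkP a b : a < b < size F -> U a b \subset blk a b /\ #|blk a b| = M.
  rewrite size_mkseq => /andP[ab bs]; rewrite /blk; case: pickP => [B /andP[? /eqP]//|nB].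
  have [|B BP] := @exists_superset _ (U a b) M; last by rewrite nB in BP.
  rewrite card_ord Mn andbT /U !nth_mkseq ?(ltn_trans ab bs) //.
  by apply: leq_trans muM; apply: leq_trans (leq_card_setU _ _) _;
    rewrite !cardA mul2n addnn.
pose bs := enum [set B | [exists a : 'I_(size F), [exists b : 'I_(size F),
                    (a < b) && (B == blk a b)]]].
pose R := @Routing n (size bs) (fun i j k b =>
  if routed_here bs i j k then
    (* On a tie the larger half goes on arc 0. *)
    if b (+) (k - j <= n - (k - j)) then uphalf d else d./2
  else 0).
have sF : size F <> 1.
  rewrite size_mkseq => s1; have := ceildiv_bounds n mu mu0; rewrite -/s s1; lia.
exists R, (cost R), M0, M, F, blk, bs.
refine (conj M0P (conj (erefl M) (conj (size_mkseq A s) (conj _ (conj _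
  (conj blkP (conj (enum_uniq _) (conj _ (conj (erefl _) (conj _ (erefl _))))))))))).
- by move=> B /mapP[a _ ->].
- apply/setP => v; rewrite inE bigcup_seq; apply/bigcupP.
  have vs : v %/ mu < s.
    rewrite ltn_divLR //; apply: leq_trans (ltn_ord v) _.
    by have /andP[] := ceildiv_bounds n mu mu0.
  exists (A (v %/ mu)); first by apply: map_f; rewrite mem_iota.
  have := ltn_ord v; have := leq_divM v mu; have := ltn_ceil v mu0.
  by rewrite inE /lo; lia.
- move=> B; rewrite mem_enum inE; split=> [/existsP[a /existsP[b /andP[ab /eqP->]]]|].
    by right; split=> //; exists a, b; rewrite ab ltn_ord.
  case=> [[/sF[]]|[_ [a [b [/andP[ab bF] ->]]]]].
  apply/existsP; exists (Ordinal (ltn_trans ab bF)); apply/existsP; exists (Ordinal bF).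
  by rewrite /= ab eqxx.
- move=> i j k _ _ /=; case: (routed_here bs i j k) => //.
  by case: (leqP (k - j) (n - (k - j))) => [le|/ltnW le]; [left|right].
Qed.

(** * Algorithm A for f >= 1: existence and ratio *)

Lemma sum_divn_modn a b (G : nat -> nat -> nat) :
  \sum_(i < a * b) G (i %/ b) (i %% b) = \sum_(x < a) \sum_(r < b) G x r.
Proof.
rewrite -(big_mkord xpredT (fun i => G (i %/ b) (i %% b))) big_nat_mul big_mkord.
apply: eq_bigr => x _; rewrite -{1}[x * b]add0n big_addn mulSn addnK big_mkord.
apply: eq_bigr => r _; have b0 : 0 < b by case: b r => [[]|].
by rewrite divnDMl // divn_small // add0n addnC modnMDl modn_small.
Qed.

(** Greedy filling: each of [k] rings takes up to [x] of what the earlier ones left. *)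
Lemma sum_chunks x d k : \sum_(r < k) minn x (d - x * r) = minn (x * k) d.
Proof.
elim: k => [|k IH]; first by rewrite big_ord0 muln0 min0n.
by rewrite big_ord_recr /= IH mulnS; lia.
Qed.

Lemma alg_A_big_exists n c d : 2 <= n -> 1 <= c ->
  exists R nadm, @alg_A_big n c d R nadm.
Proof.
move=> n2 c1; pose x0 : 'I_n := Ordinal (ltnW n2).
have c2 : 0 < 2 * c by rewrite muln_gt0.
pose s := enum [set q : 'I_n * 'I_n | q.1 < q.2]; pose K := ceildiv d (2 * c).
(* Ring [i] is copy [i %% K] for the pair of index [i %/ K]. After 2c units for each earlier copy,
   it puts up to c units on arc 0, then up to c on arc 1. *)
pose p i := nth (x0, x0) s (i %/ K).
pose R := @Routing n (size s * K) (fun i j k b => if p i == (j, k) then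
    minn c (d - 2 * c * (i %% K) - b * c) else 0).
have sum_p (q : 'I_n * 'I_n) g : q.1 < q.2 ->
    \sum_(i < size s * K) (if p i == q then g (i %% K) else 0) = \sum_(r < K) g r.
  move=> qlt; have /= -> := sum_divn_modn (size s) K
    (fun x r => if nth (x0, x0) s x == q then g r else 0).
  rewrite -(big_mkord xpredT (fun x => \sum_(r < K) if nth (x0, x0) s x == q then g r else 0)).
  rewrite -(big_nth (x0, x0) xpredT (fun q' => \sum_(r < K) if q' == q then g r else 0)).
  rewrite big_enum (bigD1 q) ?inE //= eqxx [X in _ + X]big1 ?addn0 // => q' /andP[_ /negPf->].
  by rewrite big1.
have ltp i : i < nrings R -> (p i).1 < (p i).2.
  move=> lti; have : p i \in s; last by rewrite mem_enum inE.
  apply: mem_nth; rewrite ltn_divLR //.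
  by case: (posnP K) lti => //= ->; rewrite muln0.
exists R, (2 * nrings R), p; split=> //.
- move=> j k ltjk; rewrite -sum1_card big_mkcond /=.
  under eq_bigr do rewrite inE.
  by rewrite (sum_p (j, k) (fun=> 1)) // sum_nat_const card_ord muln1.
- by move=> i j k b _ _ /= /negPf; rewrite eq_sym => ->.
split=> [j k ltjk|i lti e] /=.
  (* Both arcs together take min(2c, rest), and K copies suffice because 2cK >= d. *)
  under eq_bigr => i _.
    have -> : (if p i == (j, k) then minn c (d - 2 * c * (i %% K) - false * c) else 0) +
              (if p i == (j, k) then minn c (d - 2 * c * (i %% K) - true * c) else 0) =
              (if p i == (j, k) then minn (2 * c) (d - 2 * c * (i %% K)) else 0).
      by case: ifP => // _; lia.
    over.
  rewrite (sum_p (j, k) (fun r => minn (2 * c) (d - 2 * c * r))) // sum_chunks.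
  by have := ceildiv_bounds d (2 * c) c2; rewrite -/K /uniform_dem; lia.
rewrite /load pair_big_dep /=.
(* Only the pair [p i] uses ring [i], and each of its arcs carries at most c. *)
apply: (@leq_trans (\sum_(q : 'I_n * 'I_n) if q == p i then c else 0)); last first.
  by rewrite -big_mkcond big_pred1_eq.
rewrite big_mkcond; apply: leq_sum => -[j k] _ /=.
by rewrite (eq_sym (j, k)); do 3!case: ifP => //; rewrite geq_minl.
Qed.

(** With K rings per pair there are n(n-1)K ADMs, and 2cK < d + 2c <= 2d; the lower bound at h = 1
    gives n(n-1)d <= 2c [cost R']. *)
Lemma alg_A_big_ratio n c d (R R' : routing n) nadm :
  1 <= c -> 2 * c <= d -> alg_A_big c d R nadm ->
  feasible c (@uniform_dem n d) R' -> nadm <= 2 * cost R'.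
Proof.
move=> c1 cd [p [ltp cardp _ _ ->]] feasR'.
have -> : 2 * nrings R = n * n.-1 * ceildiv d (2 * c).
  rewrite -sum_ltn_const -{1}[nrings R]card_ord -sum1_card; congr muln.
  under [RHS]eq_bigr do under eq_bigr => k ltjk do
    rewrite -(cardp _ _ ltjk) -sum1_card big_mkcond.
  rewrite pair_big_dep exchange_big /=; apply: eq_bigr => i _.
  rewrite (bigD1 (p i)) ?ltp //= inE -surjective_pairing eqxx big1 // => -[j k].
  by rewrite inE eq_sym => /andP[_ /negPf->].
have c2 : 0 < 2 * c by rewrite muln_gt0.
have := cost_lower_bound _ _ c d 1 feasR'; rewrite mul1n !muln0 addn0.
have /andP[_] := ceildiv_bounds d (2 * c) c2.
move: (ceildiv _ _) (cost R') (n * n.-1) => K m x hK hm.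
rewrite -(leq_pmul2r c2) -mulnA; apply: (@leq_trans (x * (2 * d))); last by lia.
by rewrite leq_mul2l; apply/orP; right; lia.
Qed.

Theorem theorem2 (K : rcfType) (n c d m : nat) :
  2 <= n -> 1 <= c -> 1 <= d ->
  is_min_cost c (@uniform_dem n d) m ->
  (exists (R : routing n) (nadm : nat), alg_A_output c d R nadm) /\
  (forall (R : routing n) (nadm : nat), alg_A_output c d R nadm ->
     feasible c (@uniform_dem n d) R /\
     (nadm%:R <= 12 * Num.sqrt 2 * m%:R :> K)%R).
Proof.
move=> n2 c1 d1 [[R' [feasR' <-]] _].
(* This holds since 16/9 <= 2, and 12 times 4/3 is the factor 16. *)
have sqrt2 : (4%:R / 3%:R <= Num.sqrt 2 :> K)%R.
  rewrite -[leLHS]ger0_norm ?divr_ge0 ?ler0n // -sqrtr_sqr ler_wsqrtr //.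
  by rewrite expr_div_n -!natrX ler_pdivrMr ?ltr0n // -natrM ler_nat.
have le16 nadm : nadm <= 16 * cost R' ->
    (nadm%:R <= 12 * Num.sqrt 2 * (cost R')%:R :> K)%R.
  rewrite -(ler_nat K) natrM => /Order.POrderTheory.le_trans; apply; rewrite ler_wpM2r ?ler0n //.
  apply: Order.POrderTheory.le_trans (ler_wpM2l (ler0n K 12) sqrt2).
  by rewrite mulrA -natrM ler_pdivlMr ?ltr0n // -natrM ler_nat.
rewrite /alg_A_output; case: leqP => [cd|dc].
  split; first exact: alg_A_big_exists.
  move=> R nadm big; split; first by have [p []] := big.
  by apply: le16; have := alg_A_big_ratio _ _ _ _ R' _ c1 cd big feasR'; lia.
split; first exact: alg_A_small_exists.
move=> R nadm /(alg_A_small_correct n c d n2 d1 dc)[feasR leR].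
by split=> //; apply/le16/leR.
Qed.
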